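(* Let $1<p<\frac{7}{5}$, and let $X_1=\frac{\partial}{\partial x_1}$ and $X_2=x_1x_2\frac{\partial}{\partial x_3}$ on $\mathbb{R}^3$, with $X=(X_1,X_2)$. Let $u_0\in L^1_{\mathrm{loc}}(\mathbb{R}^3)$. If $f\in L^1_{\mathrm{loc}}(\mathbb{R}^3)$ with $\int_{\mathbb{R}^3}f(x)\,dx>0$, then the problem $u_t-\Delta_X u=|u|^p+f(x)$ in $(0,\infty)\times\mathbb{R}^3$, $u(0,x)=u_0(x)$, does not admit a global in time weak solution.
   Context: For a system $X=(X_1,\dots,X_m)$ of real $C^\infty$ vector fields, $\Delta_X=-\sum_{k=1}^m X_k^\ast X_k$ with $X_k^\ast=-X_k-\operatorname{div}X_k$; here the vector fields are divergence free, so $\Delta_X=X_1^2+X_2^2$. Weak solution (with $n=3$): for $f,u_0\in L^1_{\mathrm{loc}}(\mathbb{R}^n)$, a function $u\in L^p_{\mathrm{loc}}((0,T),L^p_{\mathrm{loc}}(\mathbb{R}^n))$ is a local in time weak solution (on $[0,T)$) of $u_t-\Delta_X u=|u|^p+f(x)$, $u(0,x)=u_0(x)$, if for every non-negative test function $\psi\in C^1_c([0,T);C^2_c(\mathbb{R}^n))$ one has $\int_0^T\!\int_{\mathbb{R}^n}|u|^p\psi+\int_{\mathbb{R}^n}u_0\psi(0,x)+\int_0^T\!\int_{\mathbb{R}^n}f\psi+\int_0^T\!\int_{\mathbb{R}^n}u\psi_t+\int_0^T\!\int_{\mathbb{R}^n}u\,\Delta_X\psi=0$. When $T=\infty$, such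 $u$ is called a global in time weak solution. *)

(* Defs.v *)
From HB Require Import structures.
From mathcomp Require Import all_boot all_order all_algebra.
From mathcomp Require Import all_classical all_reals all_analysis.

Set Implicit Arguments.
Unset Strict Implicit.
Unset Printing Implicit Defensive.

Import Order.TTheory GRing.Theory Num.Theory.
Import numFieldNormedType.Exports.

Local Open Scope classical_set_scope.
Local Open Scope ring_scope.

(* R^3 as (R * R) * R : the coordinates of x are x.1.1, x.1.2 and x.2. *)
Notation space3 R := (R * R * R)%type.

Notation lebesgue3 R :=
  ((@lebesgue_measure R \x @lebesgue_measure R) \x @lebesgue_measure R)%E.

Section calculus.
Variable R : realType.
Implicit Types (phi : space3 R -> R) (i : 'I_3) (x : space3 R).

Definition basis3 i : space3 R := ((i == 0)%:R, (i == 1)%:R, (i == 2)%:R).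

Definition partial i phi : space3 R -> R := 'D_(basis3 i) phi.

(* A vector field is given by its coefficients:
   X = \sum_i X i (x) \partial / \partial x_i. *)
Definition vector_field := 'I_3 -> space3 R -> R.

Definition vf_apply (X : vector_field) phi : space3 R -> R :=
  fun x => \sum_i X i x * partial i phi x.

Definition divergence (X : vector_field) : space3 R -> R :=
  fun x => \sum_i partial i (X i) x.

Definition vf_adjoint (X : vector_field) phi : space3 R -> R :=
  fun x => - vf_apply X phi x - divergence X x * phi x.

Definition Laplacian_of m (X : 'I_m -> vector_field) phi : space3 R -> R :=
  fun x => - \sum_k vf_adjoint (X k) (vf_apply (X k) phi) x.

Definition C1 phi := forall i,
  (forall x, derivable phi x (basis3 i)) /\ continuous (partial i phi).

Definition C2 phi := C1 phi /\ forall i, C1 (partial i phi).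

(* K is meant to be compact, hence closed, so that it contains the support *)
Definition C2_supported_in (K : set (space3 R)) phi :=
  C2 phi /\ forall x, phi x != 0 -> K x.

Definition C2_norm phi : \bar R :=
  ereal_sup [set (`|phi x| + \sum_i `|partial i phi x|
                  + \sum_i \sum_j `|partial j (partial i phi) x|)%:E
            | x in [set: space3 R]].

End calculus.

Section weak_solutions.
Variable R : realType.
Implicit Types (T : \bar R) (f : space3 R -> R).

Definition time_dom T : set R := [set t | 0 <= t /\ (t%:E < T)%E].
Definition open_time_dom T : set R := [set t | 0 < t /\ (t%:E < T)%E].

(* C^1_c([0, T); C^2_c(R^3)). Since C^2_c(R^3) is the strict inductive limit
   of the Banach spaces C^2_K, a compactly supported C^1 map has all its values
   (and those of its derivative dpsi) in a single C^2_K, and differentiability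
   and continuity are understood for the norm of C^2_K; they are one-sided at
   t = 0. *)
Definition test_function T (psi : R -> space3 R -> R) : Prop :=
  exists (K : set (space3 R)) (tau : R) (dpsi : R -> space3 R -> R),
    [/\ compact K,
        (tau%:E < T)%E,
        forall t, time_dom T t -> tau < t -> forall x, psi t x = 0 &
        forall t, time_dom T t ->
          [/\ C2_supported_in K (psi t),
              C2_supported_in K (dpsi t),
              C2_norm (fun x => (s - t)^-1 * (psi s x - psi t x) - dpsi t x)
                @[s --> within (time_dom T) (dnbhs t)] --> 0%E &
              C2_norm (fun x => dpsi s x - dpsi t x)
                @[s --> within (time_dom T) (nbhs t)] --> 0%E]].

(* Borel functions, as representatives of classes modulo a.e. equality; here
   and below u is jointly measurable in (t, x). *)
Definition L1_loc f : Prop :=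
  measurable_fun [set: measurableTypeR R * measurableTypeR R * measurableTypeR R]
    (f : _ -> measurableTypeR R) /\
  forall K : set (space3 R), compact K ->
    (\int[lebesgue3 R]_(x in K) `|f x|%:E < +oo)%E.

Definition Lp_loc_time_space T (p : R) (u : R * space3 R -> R) : Prop :=
  measurable_fun
    (open_time_dom T `*` setT
      : set (measurableTypeR R *
             (measurableTypeR R * measurableTypeR R * measurableTypeR R)))
    (u : _ -> measurableTypeR R) /\
  forall (J : set R) (K : set (space3 R)),
    J `<=` open_time_dom T -> compact J -> compact K ->
    (\int[@lebesgue_measure R]_(t in J)
       \int[lebesgue3 R]_(x in K) (`|u (t, x)| `^ p)%:E < +oo)%E.

(* The identity is stated in \bar R: an integral that diverges is +oo or -oo
   (-oo by convention for +oo - +oo), and a sum with an infinite term is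
   infinite, so the identity forces all five integrals to be finite. *)
Definition weak_solution T m (X : 'I_m -> vector_field R) (p : R) f (u0 : space3 R -> R)
    (u : R * space3 R -> R) : Prop :=
  Lp_loc_time_space T p u /\
  forall psi : R -> space3 R -> R, test_function T psi ->
    (forall t x, time_dom T t -> 0 <= psi t x) ->
    (\int[@lebesgue_measure R]_(t in open_time_dom T)
        \int[lebesgue3 R]_x (`|u (t, x)| `^ p * psi t x)%:E
     + \int[lebesgue3 R]_x (u0 x * psi 0%R x)%:E
     + \int[@lebesgue_measure R]_(t in open_time_dom T)
        \int[lebesgue3 R]_x (f x * psi t x)%:E
     + \int[@lebesgue_measure R]_(t in open_time_dom T)
        \int[lebesgue3 R]_x (u (t, x) * derive1 (psi^~ x) t)%:E
     + \int[@lebesgue_measure R]_(t in open_time_dom T)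
        \int[lebesgue3 R]_x (u (t, x) * Laplacian_of X (psi t) x)%:E = 0)%E.

Definition global_weak_solution m (X : 'I_m -> vector_field R) (p : R) f u0 u :=
  weak_solution +oo%E X p f u0 u.

End weak_solutions.

(* X_1 = d/dx_1 and X_2 = x_1 x_2 d/dx_3, with indices shifted to start at 0 *)
Definition field1 (R : realType) : vector_field R := fun i x => (i == 0)%:R.
Definition field2 (R : realType) : vector_field R :=
  fun i x => if i == 2 then x.1.1 * x.1.2 else 0.
Definition fields (R : realType) : 'I_2 -> vector_field R :=
  fun k => if k == 0 then @field1 R else @field2 R.

(* Main.v *)
(* A cutoff supported at times in [L^2, 3 L^2] vanishes at t = 0, which removes
   [u0], and keeps [u] on a compact subset of the open half line, where it is
   p-integrable.  Dilating x1, x2, x3 by L, L, L^3 makes X_1 and X_2 of order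
   1 / L, and Young's inequality absorbs the terms with psi_t and Delta_X psi
   into |u|^p psi up to an error of order (L^-2)^p' times the volume 16 L^7 of
   the support, where p' = p / (p - 1) > 7 / 2.  The error thus stays bounded,
   whereas the source term is at least a multiple of L^2, the length of the
   time interval. *)

Require Import Defs.
From HB Require Import structures.
From mathcomp Require Import all_boot all_order all_algebra.
From mathcomp Require Import all_classical all_reals all_analysis.
From mathcomp Require Import measurable_realfun.
From mathcomp Require Import ring lra.

Set Implicit Arguments.
Unset Strict Implicit.
Unset Printing Implicit Defensive.

Import Order.TTheory GRing.Theory Num.Theory.
Import numFieldNormedType.Exports.

Local Open Scope classical_set_scope.
Local Open Scope ring_scope.

(** The absorption dictates the shape of the cutoff: it requires [psi_t] and [Delta_X psi] to be
    bounded by a multiple of [psi ^ (1 / p)], hence [psi] is a high power. With [psi = q ^ (n + 3)],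
    two derivatives still leave [q ^ (n + 1)], and [q ^ ((n + 1) p) <= q ^ (n + 3)] as soon as
    [(n + 1) (p - 1) >= 2]; so [n] depends on [p]. A product of truncated parabolas in the separate
    variables is smooth enough once raised to this power, and all its derivatives stay explicit. The
    7 in the volume is the sum of the weights 1, 1, 3 of the space variables and 2 of time, and
    [p / (p - 1) = 7 / 2] exactly at [p = 7 / 5]. The weak identity lives in the extended reals, so
    the terms in [u] are shown to be finite before anything is moved across it. *)

Local Notation mspace3 R :=
  (measurableTypeR R * measurableTypeR R * measurableTypeR R)%type.
Local Notation mspacetime R := (measurableTypeR R * mspace3 R)%type.

(** * Powers of truncated parabolas and their first two derivatives *)

Section bump.
Variable R : realType.
Implicit Types (s y c r : R) (n j : nat).

Definition pos y : R := Num.max 0 y.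

Lemma pos_ge0 y : 0 <= pos y.
Proof. by rewrite /pos le_max lexx. Qed.

Lemma posP y : (0 <= y /\ pos y = y) \/ (y <= 0 /\ pos y = 0).
Proof.
rewrite /pos; case: (leP 0 y) => h; first by left.
by right; split => //; exact: ltW.
Qed.

Lemma continuous_pos : continuous pos.
Proof. by move=> y; apply: continuous_max; [exact: cvg_cst|exact: cvg_id]. Qed.

(** The first-order remainder is at most [h ^ 2] whichever side of 0 the points [y] and [h + y] lie
    on, so the kink needs no separate limit. *)
Lemma is_derive_pos2 y : is_derive y 1 (fun z => pos z ^+ 2) (2 * pos y).
Proof.
have H : (fun h => h^-1 *: ((fun z => pos z ^+ 2) (h *: (1:R) + y) - pos y ^+ 2))
    @ 0^' --> 2 * pos y.
  apply/cvgrPdist_le => e e0.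
  near=> h.
  have h0 : h != 0 by near: h; exact: nbhs_dnbhs_neq.
  have he : `|h| <= e.
    near: h; apply: nbhs_dnbhs; apply/nbhs_normP; exists e => //= z /=.
    by rewrite sub0r normrN => /ltW.
  rewrite -(ler_pM2l (x := `|h|)) ?normr_gt0// -normrM.
  have -> : h * (2 * pos y - h^-1 *: (pos (h *: (1:R) + y) ^+ 2 - pos y ^+ 2)) =
     2 * h * pos y - (pos (h + y) ^+ 2 - pos y ^+ 2).
    by rewrite /GRing.scale/= mulr1; field.
  apply: (@le_trans _ _ (h ^+ 2)).
    rewrite ler_norml.
    by case: (posP y) => -[hy ->]; case: (posP (h + y)) => -[hhy ->];
      apply/andP; split; nra.
  by rewrite -(real_normK (num_real h)) expr2 ler_wpM2l.
by apply: (DeriveDef (cvgP _ H)); exact: cvg_lim H.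
Unshelve. all: by end_near.
Qed.

(** Writing the power as [z ^ n * pos z ^ 2] confines the truncation to the square, and the product
    rule does the rest. *)
Lemma is_derive_posX n y :
  is_derive y 1 (fun z => pos z ^+ n.+2) (n.+2%:R * pos y ^+ n.+1).
Proof.
have posXE : (fun z : R => pos z ^+ n.+2) =
    (id ^+ n : R -> R) * (fun z => pos z ^+ 2).
  apply/funext => z; rewrite fctE exprfctE /= -addn2 exprD.
  by case: (posP z) => -[_ ->] //; rewrite [0 ^+ 2]expr0n/= !mulr0.
rewrite posXE.
apply: (is_derive_eq (is_deriveM (is_deriveX n (is_derive_id y 1)) (is_derive_pos2 y))).
rewrite exprfctE /GRing.scale/= !mulr1.
case: (posP y) => -[_ ->]; last first.
  by rewrite [0 ^+ n.+1]expr0n [0 ^+ 2]expr0n /= !(mulr0, mul0r) add0r.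
case: n {posXE} => [|n] /=; first by rewrite !expr0 mul0r mulr0 addr0 mul1r expr1.
by rewrite -[in RHS](addn1 n.+2) natrD -[n.+2%:R]natr1 !exprS; ring.
Qed.

Definition hump c r s := pos (1 - ((s - c) / r) ^+ 2).

(* [bump c r n j] is the [j]-th derivative, for [j <= 2], of
   [max 0 (1 - ((s - c) / r) ^ 2) ^ (n + 3)] *)
Definition bump c r n j s : R :=
  match j with
  | 0 => hump c r s ^+ n.+3
  | 1 => n.+3%:R * hump c r s ^+ n.+2 * (- 2 * ((s - c) / r) / r)
  | _ => n.+3%:R * (n.+2%:R * hump c r s ^+ n.+1 * (- 2 * ((s - c) / r) / r) ^+ 2
                    - 2 / r ^+ 2 * hump c r s ^+ n.+2)
  end.

Lemma hump_ge0 c r s : 0 <= hump c r s.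
Proof. exact: pos_ge0. Qed.

Lemma hump_le1 c r s : hump c r s <= 1.
Proof.
rewrite /hump; case: (posP (1 - ((s - c) / r) ^+ 2)) => -[h ->] //.
by rewrite lerBlDr lerDl sqr_ge0.
Qed.

Lemma hump_neq0 c r s : 0 < r -> hump c r s != 0 -> `|s - c| <= r.
Proof.
move=> r0; rewrite /hump; case: (posP (1 - ((s - c) / r) ^+ 2)) => -[h ->]; last by rewrite eqxx.
move=> _; rewrite -(ger0_norm (ltW r0)) -ler_sqr ?nnegrE// !real_normK ?num_real//.
have -> : (s - c) ^+ 2 = ((s - c) / r) ^+ 2 * r ^+ 2 by field; rewrite gt_eqF.
by rewrite ler_piMl ?sqr_ge0// -subr_ge0.
Qed.

Lemma is_derive_hump_arg c r s :
  is_derive s 1 (fun s => 1 - ((s - c) / r) ^+ 2) (- 2 * ((s - c) / r) / r).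
Proof.
have -> : (fun s => 1 - ((s - c) / r) ^+ 2) =
    (cst 1 - (r^-1 \*: (id - cst c)) ^+ 2) :> (R -> R).
  by apply/funext => z /=; rewrite !fctE /= [_ / r]mulrC.
apply: is_derive_eq.
by rewrite /GRing.scale/= !fctE /= /GRing.scale/=; ring.
Qed.

Lemma is_derive_humpX c r n s : is_derive s 1 (fun s => hump c r s ^+ n.+2)
  (n.+2%:R * hump c r s ^+ n.+1 * (- 2 * ((s - c) / r) / r)).
Proof.
exact: (is_derive1_comp (is_derive_posX n _) (is_derive_hump_arg c r s)).
Qed.

Lemma is_derive_bump c r n j s : (j < 2)%N ->
  is_derive s 1 (bump c r n j) (bump c r n j.+1 s).
Proof.
case: j => [|[|//]] _; first exact: is_derive_humpX.
have dlin : is_derive s 1 (fun s => - 2 * ((s - c) / r) / r) (- 2 / r ^+ 2).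
  have -> : (fun s => - 2 * ((s - c) / r) / r) = ((- 2 / r ^+ 2) \*: (id - cst c)) :> (R -> R).
    apply/funext => z /=; rewrite !fctE /= /GRing.scale /=.
    by rewrite expr2 invfM; ring.
  by apply: is_derive_eq; rewrite subr0 /GRing.scale/= mulr1.
have -> : bump c r n 1 = n.+3%:R \*: ((fun s => hump c r s ^+ n.+2) *
    (fun s => - 2 * ((s - c) / r) / r)).
  by apply/funext => z; rewrite /bump !fctE -mulrA.
apply: (is_derive_eq (is_deriveZ n.+3%:R (is_deriveM (is_derive_humpX c r n s) dlin))).
by rewrite /GRing.scale/= /GRing.scale/=; ring.
Qed.

Lemma continuous_hump c r : continuous (hump c r).
Proof.
move=> s; apply: (continuous_comp (f := fun s => 1 - ((s - c) / r) ^+ 2) (g := pos)).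
  apply: differentiable_continuous; apply/derivable1_diffP.
  by have [] := is_derive_hump_arg c r s.
exact: continuous_pos.
Qed.

Lemma continuous_bump c r n j : continuous (bump c r n j).
Proof.
have cX k : continuous (fun s => hump c r s ^+ k).
  by move=> s; apply: (continuous_comp (g := fun y => y ^+ k));
    [exact: continuous_hump|exact: exprn_continuous].
have clin : continuous (fun s => - 2 * ((s - c) / r) / r).
  move=> s; apply: cvgM; last exact: cvg_cst.
  apply: cvgM; first exact: cvg_cst.
  by apply: cvgM; [apply: cvgB; [exact: cvg_id|exact: cvg_cst]|exact: cvg_cst].
case: j => [|[|j]] s /=; first exact: cX.
- by apply: cvgM; [apply: cvgM; [exact: cvg_cst|exact: cX]|exact: clin].
- apply: cvgM; first exact: cvg_cst.
  apply: cvgB; last by apply: cvgM; [exact: cvg_cst|exact: cX].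
  apply: cvgM; last by apply: cvgM; exact: clin.
  by apply: cvgM; [exact: cvg_cst|exact: cX].
Qed.

(** Each derivative costs one factor [1 / r] and at most one power of the hump. Since the hump is at
    most 1, every power is weakened to the lowest one, [n.+1], and a single constant serves all
    three orders. *)
Lemma bump_bound c r n j s : 0 < r -> (j <= 2)%N ->
  `|bump c r n j s| <= 4 * n.+3%:R ^+ 2 / r ^+ j * hump c r s ^+ n.+1.
Proof.
move=> r0 j2.
have q0 := hump_ge0 c r s.
have q1 := hump_le1 c r s.
have P0 : 0 <= hump c r s ^+ n.+1 by rewrite exprn_ge0.
have P1 : hump c r s ^+ n.+2 <= hump c r s ^+ n.+1 by rewrite exprS ler_piMl.
have n3 : 3 <= n.+3%:R :> R by rewrite ler_nat.
(* Where the hump vanishes so do both sides; elsewhere [|(s - c) / r| <= 1], which controls the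
   inner derivative. *)
have [qn0|qn0] := eqVneq (hump c r s) 0.
  rewrite [in leRHS]qn0 [0 ^+ n.+1]expr0n mulr0 normr_le0.
  by case: j j2 => [|[|[|//]]] _ /=; rewrite qn0 !expr0n /= ?mulr0 ?mul0r ?subrr ?mulr0.
have zr : `|(s - c) / r| <= 1.
  by rewrite normrM normfV (gtr0_norm r0) ler_pdivrMr// mul1r hump_neq0.
set z := (s - c) / r in zr *.
have ir : 0 < r^-1 by rewrite invr_gt0.
case: j j2 => [|[|[|//]]] _ /=.
- rewrite ger0_norm ?exprn_ge0// expr0 divr1.
  have : hump c r s ^+ n.+3 <= hump c r s ^+ n.+1.
    by apply: le_trans P1; rewrite [leLHS]exprS ler_piMl// exprn_ge0.
  nra.
- rewrite -/z expr1.
  have -> : n.+3%:R * hump c r s ^+ n.+2 * (- 2 * z / r) =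
    - (2 * n.+3%:R / r) * (hump c r s ^+ n.+2 * z) by ring.
  have a0 : 0 <= 2 * n.+3%:R / r by rewrite !mulr_ge0// ltW.
  rewrite normrM normrN (ger0_norm a0).
  have : `|hump c r s ^+ n.+2 * z| <= hump c r s ^+ n.+1.
    rewrite normrM ger0_norm ?exprn_ge0//.
    by apply: le_trans P1; rewrite ler_piMr// exprn_ge0.
  move=> h; apply: ler_pM => //.
  rewrite ler_pM2r//; nra.
- rewrite -/z.
  have -> : n.+3%:R * (n.+2%:R * hump c r s ^+ n.+1 * (- 2 * z / r) ^+ 2 -
     2 / r ^+ 2 * hump c r s ^+ n.+2) =
     r^-1 ^+ 2 * (n.+3%:R * (4 * n.+2%:R * (hump c r s ^+ n.+1 * z ^+ 2) - 2 * hump c r s ^+ n.+2)).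
    by rewrite -exprVn; ring.
  rewrite -exprVn normrM (ger0_norm (sqr_ge0 _)).
  have -> : 4 * n.+3%:R ^+ 2 * r^-1 ^+ 2 * hump c r s ^+ n.+1 =
    r^-1 ^+ 2 * (4 * n.+3%:R ^+ 2 * hump c r s ^+ n.+1) by ring.
  rewrite ler_pM2l ?exprn_gt0// normrM (ger0_norm (ler0n _ _)).
  have -> : 4 * n.+3%:R ^+ 2 * hump c r s ^+ n.+1 =
    n.+3%:R * (4 * n.+3%:R * hump c r s ^+ n.+1) by ring.
  rewrite ler_pM2l ?ltr0n//.
  have z2 : z ^+ 2 <= 1 by rewrite -real_normK ?num_real// expr_le1.
  have z20 := sqr_ge0 z.
  have n32 : n.+3%:R = n.+2%:R + 1 :> R by rewrite -natr1.
  have n2 : 2 <= n.+2%:R :> R by rewrite ler_nat.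
  have P2 : 0 <= hump c r s ^+ n.+2 by rewrite exprn_ge0.
  rewrite n32 ler_norml.
  set P := _ ^+ n.+1 in P0 P1 *; set Q := _ ^+ n.+2 in P1 P2 *.
  set m : R := n.+2%:R in n2 *.
  have PZ0 : 0 <= P * z ^+ 2 by rewrite mulr_ge0.
  have PZ1 : P * z ^+ 2 <= P by rewrite ler_piMr.
  by apply/andP; split; nra.
Qed.

End bump.

(** * Products of one-variable functions, their C^2 norm and their image under Delta_X *)

Section separated_functions.
Variable R : realType.
Implicit Types (x v : space3 R) (i k : 'I_3) (phi : space3 R -> R).

(** A directional derivative sees only the restriction to a line, which reduces partial derivatives
    to one-variable calculus. *)
Lemma is_derive_along phi x v (g : R -> R) (c d : R) :
  (forall h, phi (h *: v + x) = g (h + c)) -> is_derive c 1 g d ->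
  is_derive x v phi d.
Proof.
move=> phig [dg <-].
have phixE : phi x = g c by have := phig 0; rewrite scale0r add0r add0r.
have E : (fun h => h^-1 *: ((phi \o shift x) (h *: v) - phi x)) =
         (fun h => h^-1 *: ((g \o shift c) (h *: (1 : R)) - g c)).
  by apply/funext => h; rewrite /= phig phixE /GRing.scale/= mulr1.
by split; rewrite /derivable /derive E.
Qed.

(** Meant for the coefficient [x1 * x2] of the second field, which is constant along the direction
    of [x3]. *)
Lemma is_derive_mul_along (a : space3 R -> R) phi x v (d : R) :
  (forall h, a (h *: v + x) = a x) -> is_derive x v phi d ->
  is_derive x v (fun y => a y * phi y) (a x * d).
Proof.
move=> ax dphi.
have : is_derive x v (a x \*: phi) (a x * d) by exact: is_deriveZ.
have E : (fun h : R => h^-1 *: (((a x \*: phi) \o shift x) (h *: v) - (a x \*: phi) x)) =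
         (fun h => h^-1 *: (((fun y => a y * phi y) \o shift x) (h *: v) - a x * phi x)).
  by apply/funext => h; rewrite /= ax.
by move=> [d1 d2]; split; rewrite /derivable /derive -E.
Qed.

Definition coord i x : R := if i == 0 then x.1.1 else if i == 1 then x.1.2 else x.2.

Lemma coord_line i k (h : R) x :
  coord k (h *: basis3 R i + x) = h * (k == i)%:R + coord k x.
Proof.
case: i => [[|[|[|i]]] ?] //; case: k => [[|[|[|k]]] ?] //;
  by rewrite /coord /basis3 /= /GRing.scale.
Qed.

Lemma continuous_coord i : continuous (coord i).
Proof.
move=> x; rewrite /coord; case: (i == 0); last case: (i == 1).
- by apply: (continuous_comp (f := fst) (g := fst)); exact: cvg_fst.
- by apply: (continuous_comp (f := fst) (g := snd)); [exact: cvg_fst|exact: cvg_snd].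
- exact: cvg_snd.
Qed.

Lemma partial_scale i phi (c : R) : (forall x, derivable phi x (basis3 R i)) ->
  partial i (fun x => c * phi x) = (fun x => c * partial i phi x).
Proof. by move=> dphi; apply/funext => x; exact: (deriveZ c (dphi x)). Qed.

Lemma C1_scale phi (c : R) : C1 phi -> C1 (fun x => c * phi x).
Proof.
move=> C1phi i; have [dphi cphi] := C1phi i; split.
  by move=> x; exact: (derivableZ (k := c) (dphi x)).
by rewrite partial_scale// => x; apply: cvgM; [exact: cvg_cst|exact: cphi].
Qed.

Lemma C2_scale phi (c : R) : C2 phi -> C2 (fun x => c * phi x).
Proof.
move=> [C1phi C1dphi]; split; first exact: C1_scale.
move=> i; rewrite partial_scale; first exact: C1_scale.
by have [] := C1phi i.
Qed.

Lemma C2_norm_scale phi (c : R) : C2 phi ->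
  (C2_norm (fun x => (c * phi x)%R) <= `|c|%:E * C2_norm phi)%E.
Proof.
move=> [C1phi C1dphi]; apply: ge_ereal_sup => _ [x _ <-].
apply: (@le_trans _ _ (`|c|%:E * (`|phi x| + \sum_i `|partial i phi x|
                  + \sum_i \sum_j `|partial j (partial i phi) x|)%:E)%E); last first.
  by apply: lee_wpmul2l; [rewrite lee_fin|apply: ereal_sup_ubound; exists x].
rewrite -EFinM lee_fin normrM !mulrDr !mulr_sumr lerD// ?lerD//.
  apply: ler_sum => i _; have [dphi _] := C1phi i.
  by rewrite partial_scale// normrM.
apply: ler_sum => i _; rewrite mulr_sumr; apply: ler_sum => j _.
have [dphi _] := C1phi i; have [ddphi _] := C1dphi i j.
by rewrite partial_scale// partial_scale// normrM.
Qed.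

Lemma C2_norm_ge0 phi : (0 <= C2_norm phi)%E.
Proof.
apply: (@le_trans _ _ (`|phi 0| + \sum_i `|partial i phi 0|
                  + \sum_i \sum_j `|partial j (partial i phi) 0|)%:E).
  rewrite lee_fin !addr_ge0// ?sumr_ge0// => i _.
  by rewrite sumr_ge0.
by apply: ereal_sup_ubound; exists 0.
Qed.

Variable G : 'I_3 -> nat -> R -> R.

(** [G i j] stands for the [j]-th derivative of the [i]-th factor and [a] for a multi-index, so a
    partial derivative amounts to incrementing one entry of [a]. *)
Definition sep (a : 'I_3 -> nat) x := \prod_i G i (a i) (coord i x).

Hypothesis dG : forall i j (s : R), (j < 2)%N -> is_derive s 1 (G i j) (G i j.+1 s).
Hypothesis cG : forall i j, continuous (G i j).

Lemma is_derive_sep a i x : (a i < 2)%N ->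
  is_derive x (basis3 R i) (sep a) (sep (fun k => (k == i) + a k)%N x).
Proof.
move=> ai2.
set C := \prod_(k | k != i) G k (a k) (coord k x).
apply: (@is_derive_along _ _ _ (fun s => G i (a i) s * C) (coord i x)).
  move=> h; rewrite /sep (bigD1 i)//= coord_line eqxx mulr1; congr (_ * _).
  by apply: eq_bigr => k ki; rewrite coord_line (negbTE ki) mulr0 add0r.
have -> : sep (fun k => (k == i) + a k)%N x = C * G i (a i).+1 (coord i x).
  rewrite /sep (bigD1 i)//= eqxx mulrC; congr (_ * _).
  by apply: eq_bigr => k ki; rewrite (negbTE ki).
have dGi := dG i (coord i x) ai2.
have -> : (fun s => G i (a i) s * C) = C \*: G i (a i).
  by apply/funext => s; rewrite mulrC.
exact: is_deriveZ.
Qed.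

Lemma partial_sep a i : (a i < 2)%N ->
  partial i (sep a) = sep (fun k => (k == i) + a k)%N.
Proof.
by move=> ai2; apply/funext => x; have [_ ] := is_derive_sep x ai2.
Qed.

Lemma continuous_sep a : continuous (sep a).
Proof.
have cGi i : continuous (fun x => G i (a i) (coord i x)).
  move=> x; apply: (continuous_comp (f := coord i) (g := G i (a i))).
    exact: continuous_coord.
  exact: cG.
suff H r : continuous (fun x => \prod_(i <- r) G i (a i) (coord i x)) by exact: H.
elim: r => [|i r IH].
  by under eq_fun do rewrite big_nil; exact: cst_continuous.
under eq_fun do rewrite big_cons.
by move=> x; apply: cvgM; [exact: cGi|exact: IH].
Qed.

Lemma C1_sep a : (forall i, a i < 2)%N -> C1 (sep a).
Proof.
move=> a2 i; split => [x|]; first by have [] := is_derive_sep x (a2 i).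
by rewrite partial_sep//; exact: continuous_sep.
Qed.

Lemma C2_sep : C2 (sep (fun=> 0%N)).
Proof.
split; first exact: C1_sep.
by move=> i; rewrite partial_sep//; apply: C1_sep => k; case: eqP.
Qed.

Lemma sep_bound a (B : R) : (forall i s, `|G i (a i) s| <= B) ->
  forall x, `|sep a x| <= B ^+ 3.
Proof.
move=> GB x; rewrite /sep normr_prod -[X in B ^+ X]card_ord -prodr_const.
by apply: ler_prod => i _; rewrite normr_ge0/= GB.
Qed.

(** The 13 counts the value, the 3 first and the 9 second derivatives, each a product of three
    factors bounded by [B]. *)
Lemma C2_norm_sep (B : R) : (forall i j s, (j <= 2)%N -> `|G i j s| <= B) ->
  (C2_norm (sep (fun=> 0%N)) <= (13 * B ^+ 3)%:E)%E.
Proof.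
move=> GB; apply: ge_ereal_sup => _ [x _ <-]; rewrite lee_fin.
have -> : 13 * B ^+ 3 = B ^+ 3 + \sum_(i < 3) B ^+ 3 + \sum_(i < 3) \sum_(j < 3) B ^+ 3.
  by rewrite !big_ord_recl !big_ord0; ring.
apply: lerD; first apply: lerD.
- by apply: sep_bound => *; exact: GB.
- apply: ler_sum => i _; rewrite partial_sep//.
  by apply: sep_bound => k s; apply: GB; case: eqP.
- apply: ler_sum => i _; apply: ler_sum => j _; rewrite partial_sep//.
  rewrite partial_sep; last by case: eqP.
  by apply: sep_bound => k s; apply: GB; case: eqP => _; case: eqP.
Qed.

Lemma vf_apply_field1 phi : vf_apply (@field1 R) phi = partial 0 phi.
Proof.
apply/funext => x; rewrite /vf_apply (bigD1 0)//= /field1 eqxx mul1r big1 ?addr0// => i i0.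
by rewrite (negbTE i0) mul0r.
Qed.

Lemma vf_apply_field2 phi :
  vf_apply (@field2 R) phi = (fun x => x.1.1 * x.1.2 * partial 2 phi x).
Proof.
apply/funext => x; rewrite /vf_apply (bigD1 2)//= /field2 eqxx big1 ?addr0// => i i0.
by rewrite (negbTE i0) mul0r.
Qed.

Lemma partial_cst i (c : R) : partial i (fun=> c) = fun=> 0.
Proof. by apply/funext => x; exact: derive_cst. Qed.

Lemma coord_line2 (h : R) x : (h *: basis3 R 2 + x).1 = x.1.
Proof.
have x1 : coord 0 (h *: basis3 R 2 + x) = coord 0 x.
  by rewrite coord_line /= mulr0 add0r.
have x2 : coord 1 (h *: basis3 R 2 + x) = coord 1 x.
  by rewrite coord_line /= mulr0 add0r.
by rewrite [LHS]surjective_pairing [RHS]surjective_pairing; congr (_, _).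
Qed.

Lemma divergence_field1 : divergence (@field1 R) = fun=> 0.
Proof.
by apply/funext => x; rewrite /divergence big1// => i _; rewrite /field1 partial_cst.
Qed.

Lemma divergence_field2 : divergence (@field2 R) = fun=> 0.
Proof.
apply/funext => x; rewrite /divergence big1// => i _; rewrite /field2.
case: eqP => [->|_]; last by rewrite partial_cst.
have H : is_derive x (basis3 R 2) (fun x => x.1.1 * x.1.2) 0.
  apply: (@is_derive_along _ _ _ (cst (x.1.1 * x.1.2)) 0) => h.
  by rewrite coord_line2.
by have [] := H.
Qed.

Lemma Laplacian_fieldsE phi x : Laplacian_of (@fields R) phi x =
  partial 0 (partial 0 phi) x +
  x.1.1 * x.1.2 * partial 2 (fun y => y.1.1 * y.1.2 * partial 2 phi y) x.
Proof.
rewrite /Laplacian_of big_ord_recl big_ord1 /vf_adjoint.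
rewrite [fields ord0]/(@field1 R) [fields (lift _ _)]/(@field2 R).
rewrite divergence_field1 divergence_field2 !vf_apply_field1 !vf_apply_field2.
by rewrite !mul0r !subr0 opprD !opprK.
Qed.

Lemma partial2_sep (c : R) i : partial i (partial i (fun x => c * sep (fun=> 0%N) x)) =
  fun x => c * sep (fun k => 2 * (k == i))%N x.
Proof.
have dsep a y : (a i < 2)%N -> derivable (sep a) y (basis3 R i).
  by move=> a2; have [] := is_derive_sep y a2.
rewrite partial_scale => [|y]; last exact: dsep.
rewrite partial_sep// partial_scale => [|y]; last by apply: dsep; case: eqP.
rewrite partial_sep; last by case: eqP.
by apply/funext => y; congr (_ * sep _ _); apply/funext => k; case: eqP.
Qed.

(** As [x1 * x2] does not depend on [x3], the square of the second field is [(x1 * x2) ^ 2] times a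
    pure second derivative, with no first-order term. *)
Lemma Laplacian_sep (c : R) x : Laplacian_of (@fields R) (fun x => c * sep (fun=> 0%N) x) x =
  c * (sep (fun k => 2 * (k == 0%R))%N x +
       (x.1.1 * x.1.2) ^+ 2 * sep (fun k => 2 * (k == 2%R))%N x).
Proof.
rewrite Laplacian_fieldsE partial2_sep.
have -> y : partial 2 (fun y => y.1.1 * y.1.2 * partial 2 (fun x => c * sep (fun=> 0%N) x) y) y =
    y.1.1 * y.1.2 * (c * sep (fun k => 2 * (k == 2%R))%N y).
  have -> : c * sep (fun k => 2 * (k == 2%R))%N y =
      partial 2 (partial 2 (fun x => c * sep (fun=> 0%N) x)) y by rewrite partial2_sep.
  have H : derivable (partial 2 (fun x => c * sep (fun=> 0%N) x)) y (basis3 R 2).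
    by have [_ /(_ 2 2)[]] := C2_scale c C2_sep.
  have /derivableP dH := H.
  have [_] := is_derive_mul_along (a := fun y => y.1.1 * y.1.2)
    (fun h => congr1 (fun z => z.1 * z.2) (coord_line2 h y)) dH.
  by [].
ring.
Qed.

End separated_functions.

(** * Test functions of the form eta(t) phi(x) *)

Section separated_test_functions.
Variable R : realType.

Lemma C2_norm_scale_cvg0 (phi : space3 R -> R) (T : Type) (F : set_system T) (c : T -> R) :
  Filter F -> C2 phi -> (C2_norm phi < +oo)%E ->
  c s @[s --> F] --> (0 : R) -> C2_norm (fun x => c s * phi x) @[s --> F] --> 0%E.
Proof.
move=> FF C2phi phioo c0.
have phifin : C2_norm phi \is a fin_num by rewrite ge0_fin_numE ?C2_norm_ge0.
have lim0 : (`|c s| * fine (C2_norm phi))%:E @[s --> F] --> 0%E.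
  apply: cvg_EFin; first by near=> s.
  rewrite -[X in _ --> X](mul0r (fine (C2_norm phi))).
  apply: cvgM; last exact: cvg_cst.
  by rewrite -(normr0 R); exact: cvg_norm.
apply: (squeeze_cvge _ (cvg_cst 0%E) lim0).
near=> s; rewrite C2_norm_ge0/= EFinM fineK//; exact: C2_norm_scale.
Unshelve. all: by end_near.
Qed.

Lemma is_derive_cvg_slope (g : R -> R) (t d : R) : is_derive t 1 g d ->
  (s - t)^-1 * (g s - g t) @[s --> dnbhs t] --> d.
Proof.
move=> [dg <-]; apply/cvgrPdist_lt => e e0.
have /cvgrPdist_lt /(_ _ e0) /nbhs_ballP[r /= r0 H] := dg.
apply/nbhs_ballP; exists r => //= s rs st.
have := H (s - t); rewrite /= /GRing.scale/= mulr1 subrK; apply.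
  by rewrite /ball/= sub0r normrN distrC.
by rewrite subr_eq0.
Qed.

(** Both differences whose C^2 norm must tend to 0 are scalars depending on time multiplied by the
    fixed [phi], so only scalar limits remain. *)
Lemma test_function_separated (phi : space3 R -> R) (K : set (space3 R))
    (eta deta : R -> R) (tau : R) :
  compact K -> C2_supported_in K phi -> (C2_norm phi < +oo)%E ->
  (forall t : R, is_derive t 1 eta (deta t)) -> continuous deta ->
  (forall t, tau < t -> eta t = 0) ->
  test_function +oo%E (fun t x => eta t * phi x).
Proof.
move=> cK [C2phi Kphi] phioo deriv_eta cdeta eta0.
exists K, tau, (fun t x => deta t * phi x); split; [exact: cK|exact: ltry|..].
  by move=> t _ taut x; rewrite eta0// mul0r.
have supp c : C2_supported_in K (fun x => c * phi x).
  split; first exact: C2_scale.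
  by move=> x; rewrite mulf_eq0 negb_or => /andP[_ /Kphi].
move=> t tpos; split; [exact: supp|exact: supp|..].
- have E : (fun s => C2_norm (fun x =>
      (s - t)^-1 * (eta s * phi x - eta t * phi x) - deta t * phi x)) =
           (fun s => C2_norm (fun x => ((s - t)^-1 * (eta s - eta t) - deta t) * phi x)).
    by apply/funext => s; congr C2_norm; apply/funext => x; ring.
  rewrite E; apply: (C2_norm_scale_cvg0 _ C2phi phioo).
  (* [eta] is differentiable on the whole line, so the two-sided limit restricts to the half line,
     including at its endpoint 0. *)
  apply: cvg_within_filter.
  have H := cvgB (is_derive_cvg_slope (deriv_eta t)) (cvg_cst (deta t)).
  rewrite subrr in H; exact: H.
- have E : (fun s => C2_norm (fun x => deta s * phi x - deta t * phi x)) =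
           (fun s => C2_norm (fun x => (deta s - deta t) * phi x)).
    by apply/funext => s; congr C2_norm; apply/funext => x; ring.
  rewrite E; apply: (C2_norm_scale_cvg0 _ C2phi phioo).
  apply: cvg_within_filter.
  have H := cvgB (cdeta t) (cvg_cst (deta t)).
  rewrite subrr in H; exact: H.
Qed.

End separated_test_functions.

(** * Young's inequality with a weight *)

Section young.
Variable R : realType.

(* Young's inequality with the power of the cutoff [q] tracked on both sides *)
Lemma young_cutoff (a b q p : R) (n : nat) : 0 <= a -> 0 <= b -> 0 <= q <= 1 ->
  1 < p -> 2 <= n.+1%:R * (p - 1) ->
  a * (b * q ^+ n.+1) <= a `^ p * q ^+ n.+3 + b `^ (p / (p - 1)).
Proof.
move=> a0 b0 /andP[q0 q1] p1 np.
have p10 : 0 < p - 1 by rewrite subr_gt0.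
have pneq0 : p != 0 by rewrite gt_eqF// (lt_trans ltr01).
(* A dichotomy replaces convexity and gives both terms the constant 1. Below the threshold, the
   product is at most the first term. Above it, [(n + 1) (p - 1) >= 2] bounds the power [p - 1] of
   [a * q ^+ n.+1] by the threshold, hence by [b], and the second term dominates. *)
have [ha|ha] := leP b (a `^ (p - 1) * q ^+ 2).
  apply: (@le_trans _ _ (a `^ p * q ^+ n.+3)); last by rewrite lerDl powR_ge0.
  have -> : a `^ p = a * a `^ (p - 1).
    have pE : p = 1 + (p - 1) by ring.
    by rewrite [in LHS]pE [LHS]powRD ?powRr1// -pE (negbTE pneq0).
  rewrite -mulrA ler_wpM2l// -addn2 exprD mulrCA [leRHS]mulrC ler_wpM2r//.
  by rewrite exprn_ge0.
apply: (@le_trans _ _ (b `^ (p / (p - 1)))); last by rewrite lerDr mulr_ge0 ?powR_ge0 ?exprn_ge0.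
have -> : b `^ (p / (p - 1)) = b * b `^ (p - 1)^-1.
  have -> : p / (p - 1) = 1 + (p - 1)^-1 by field; rewrite gt_eqF.
  by rewrite powRD ?powRr1// gt_eqF ?addr_gt0 ?invr_gt0.
rewrite mulrCA ler_wpM2l//.
have -> : a * q ^+ n.+1 = ((a * q ^+ n.+1) `^ (p - 1)) `^ (p - 1)^-1.
  by rewrite -powRrM divff ?gt_eqF// powRr1// mulr_ge0 ?exprn_ge0.
apply: ge0_ler_powR; rewrite ?nnegrE ?powR_ge0//; first by rewrite ltW ?invr_gt0.
apply: le_trans (ltW ha); rewrite powRM ?exprn_ge0// ler_wpM2l ?powR_ge0//.
rewrite -!powR_mulrn// -powRrM.
(* Monotonicity in the exponent is applied to a positive base; at [q = 0] both exponents are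
   nonzero, so both sides are 0. *)
have [->|qn0] := eqVneq q 0.
  by rewrite !powR0// ?pnatr_eq0// mulf_neq0// gt_eqF.
by apply: ger_powR => //; rewrite lt_neqAle eq_sym qn0 q0.
Qed.

End young.

(** * The cutoff at scale L and the bound on the operator applied to it *)

Section scaled_cutoff.
Variables (R : realType) (n : nat).
Implicit Types (L t : R) (x : space3 R) (a : 'I_3 -> nat).

(* the anisotropic dilation of [R^3], under which X_1 and X_2 have degree 1 *)
Definition radius L (i : 'I_3) : R := if i == 2 then L ^+ 3 else L.

Definition jets L (i : 'I_3) (j : nat) : R -> R := bump 0 (radius L i) n j.

Definition cutoff L x : R := sep (jets L) (fun=> 0%N) x.

Definition time_cutoff L t : R := bump (2 * L ^+ 2) (L ^+ 2) n 0 t.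
Definition dtime_cutoff L t : R := bump (2 * L ^+ 2) (L ^+ 2) n 1 t.

(** The product of the humps before raising to the power [n.+3]; multiplied by [base_time_cutoff],
    it is the weight [q] to which Young's inequality is applied. *)
Definition base_cutoff L x : R := \prod_i hump 0 (radius L i) (coord i x).
Definition base_time_cutoff L t : R := hump (2 * L ^+ 2) (L ^+ 2) t.

Definition time_itv L : set R := `[L ^+ 2, 3 * L ^+ 2].
Definition box L : set (space3 R) :=
  (`[- L, L] `*` `[- L, L]) `*` `[- (L ^+ 3), L ^+ 3].

Lemma cutoffE L x : cutoff L x = base_cutoff L x ^+ n.+3.
Proof. by rewrite /cutoff /sep /base_cutoff -prodrXl. Qed.

Lemma time_cutoffE L t : time_cutoff L t = base_time_cutoff L t ^+ n.+3.
Proof. by []. Qed.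

Lemma base_cutoff_ge0 L x : 0 <= base_cutoff L x.
Proof. by apply: prodr_ge0 => i _; exact: hump_ge0. Qed.

Lemma base_cutoff_le1 L x : base_cutoff L x <= 1.
Proof. by apply: prodr_ile1 => i _; rewrite hump_ge0 hump_le1. Qed.

Lemma radius_gt0 L i : 0 < L -> 0 < radius L i.
Proof. by move=> L0; rewrite /radius; case: eqP => // _; rewrite exprn_gt0. Qed.

Lemma base_cutoff_box L x : 0 < L -> base_cutoff L x != 0 -> box L x.
Proof.
move=> L0 /prodf_neq0 h.
have hi i : `|coord i x| <= radius L i.
  by rewrite -[coord i x]subr0; apply: hump_neq0; [exact: radius_gt0|exact: h].
have := hi 0; have := hi 1; have := hi 2.
rewrite /coord /radius /= !ler_norml => h2 h1 h0.
by split; [split|]; rewrite /= in_itv.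
Qed.

Lemma base_time_cutoff_itv L t : 0 < L -> base_time_cutoff L t != 0 -> time_itv L t.
Proof.
move=> L0 h; have := hump_neq0 (exprn_gt0 2 L0) h.
rewrite ler_norml /time_itv /= in_itv /= => /andP[h1 h2]; apply/andP; split; lra.
Qed.

Lemma is_derive_jets L i j (s : R) : (j < 2)%N -> is_derive s 1 (jets L i j) (jets L i j.+1 s).
Proof. exact: is_derive_bump. Qed.

Lemma continuous_jets L i j : continuous (jets L i j).
Proof. exact: continuous_bump. Qed.

Let B : R := 4 * n.+3%:R ^+ 2.

Lemma bump_constant_ge0 : 0 <= B.
Proof. by rewrite mulr_ge0 ?exprn_ge0. Qed.

Lemma C2_cutoff L : C2 (cutoff L).
Proof. by apply: C2_sep; [exact: is_derive_jets|exact: continuous_jets]. Qed.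

Lemma C2_norm_cutoff L : 1 <= L -> (C2_norm (cutoff L) < +oo)%E.
Proof.
move=> L1; have L0 : 0 < L by apply: lt_le_trans L1.
apply: (le_lt_trans (C2_norm_sep (@is_derive_jets L) (B := B) _)); last exact: ltry.
move=> i j s j2; apply: (le_trans (bump_bound _ _ _ (radius_gt0 _ L0) j2)).
rewrite -/B -mulrA ler_piMr ?bump_constant_ge0// mulr_ile1 ?exprn_ge0 ?hump_ge0//.
- by rewrite invr_ge0 exprn_ge0// ltW// radius_gt0.
- rewrite invf_le1 ?exprn_gt0 ?radius_gt0// exprn_ege1// /radius.
  by case: eqP => // _; rewrite exprn_ege1.
- by rewrite exprn_ile1 ?hump_ge0 ?hump_le1.
Qed.

Lemma jets_sep_bound L a x : 0 < L -> (forall i, a i <= 2)%N ->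
  `|sep (jets L) a x| <= B ^+ 3 * (\prod_i (radius L i ^+ a i)^-1) * base_cutoff L x ^+ n.+1.
Proof.
move=> L0 a2; rewrite /sep normr_prod.
have -> : B ^+ 3 * (\prod_i (radius L i ^+ a i)^-1) * base_cutoff L x ^+ n.+1 =
  \prod_i (B / radius L i ^+ a i * hump 0 (radius L i) (coord i x) ^+ n.+1).
  by rewrite /base_cutoff -prodrXl 2!big_split /= prodr_const card_ord.
apply: ler_prod => i _; rewrite normr_ge0 /=.
by apply: bump_bound => //; exact: radius_gt0.
Qed.

(** Three terms, from the time derivative and the squares of the two fields, each a product of four
    one-variable factors with constant [B]. *)
Definition operator_constant : R := 3 * B ^+ 4.

(** All three terms scale as [L ^ -2]: one derivative in time at radius [L ^ 2], two in [x1] at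
    radius [L], and two in [x3] at radius [L ^ 3], where [L ^ -6] is compensated by the coefficient,
    at most [L ^ 4] on the box. *)
Lemma operator_bound L t x : 1 <= L ->
  `|dtime_cutoff L t * cutoff L x| +
  `|Laplacian_of (@fields R) (fun y => time_cutoff L t * cutoff L y) x| <=
  operator_constant / L ^+ 2 * (base_time_cutoff L t * base_cutoff L x) ^+ n.+1.
Proof.
move=> L1; have L0 : 0 < L by apply: lt_le_trans L1.
have iL0 : 0 <= (L ^+ 2)^-1 by rewrite invr_ge0 exprn_ge0// ltW.
have B0 := bump_constant_ge0.
set q := base_cutoff L x; set s := base_time_cutoff L t.
have q0 : 0 <= q ^+ n.+1 by rewrite exprn_ge0// base_cutoff_ge0.
have s0 : 0 <= s ^+ n.+1 by rewrite exprn_ge0// hump_ge0.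
have L20 : 0 < L ^+ 2 by rewrite exprn_gt0.
have bt := bump_bound (2 * L ^+ 2) n t L20 (isT : (0 <= 2)%N).
have bdt := bump_bound (2 * L ^+ 2) n t L20 (isT : (1 <= 2)%N).
rewrite -/B -/(base_time_cutoff L t) -/s expr0 divr1 -/(time_cutoff L t) in bt.
rewrite -/B -/(base_time_cutoff L t) -/s expr1 -/(dtime_cutoff L t) in bdt.
have b0 : `|cutoff L x| <= B ^+ 3 * q ^+ n.+1.
  have := @jets_sep_bound L (fun=> 0%N) x L0 (fun=> isT).
  by rewrite -/(cutoff L x) -/q big1 ?mulr1// => i _; rewrite expr0 invr1.
have b1 : `|sep (jets L) (fun k => 2 * (k == 0%R))%N x| <= B ^+ 3 / L ^+ 2 * q ^+ n.+1.
  have /(_ _)/le_trans := @jets_sep_bound L (fun k => 2 * (k == 0%R))%N x L0; apply.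
    by move=> i; case: eqP.
  by rewrite !big_ord_recl big_ord0 /radius /= !expr0 !invr1 !mulr1.
have b2 : `|(x.1.1 * x.1.2) ^+ 2 * sep (jets L) (fun k => 2 * (k == 2%R))%N x| <=
    B ^+ 3 / L ^+ 2 * q ^+ n.+1.
  have := @jets_sep_bound L (fun k => 2 * (k == 2%R))%N x L0.
  rewrite -/q => /(_ _)/= h2; rewrite normrM.
  have {}h2 : `|sep (jets L) (fun k => 2 * (k == 2%R))%N x| <= B ^+ 3 / L ^+ 6 * q ^+ n.+1.
    apply: le_trans (h2 _) _; first by move=> i; case: eqP.
    rewrite !big_ord_recl big_ord0 /radius /= !expr0 !invr1 !mul1r mulr1.
    by rewrite -exprM.
  (* Off the box the coefficient is not controlled, but where [q] vanishes [h2] forces the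
     derivative of the cutoff to be 0. *)
  have [qn0|qn0] := eqVneq q 0.
    move: h2; rewrite qn0 expr0n /= !mulr0 normr_le0 => /eqP ->.
    by rewrite normr0 mulr0.
  have [[/= x1 x2] _] := base_cutoff_box L0 qn0.
  have xL : `|(x.1.1 * x.1.2) ^+ 2| <= L ^+ 4.
    move: x1 x2; rewrite !in_itv /= -!ler_norml => x1 x2.
    rewrite normrX normrM (_ : L ^+ 4 = (L * L) ^+ 2); last by ring.
    by rewrite lerXn2r ?nnegrE ?mulr_ge0 ?(ltW L0)// ler_pM.
  have -> : B ^+ 3 / L ^+ 2 * q ^+ n.+1 = L ^+ 4 * (B ^+ 3 / L ^+ 6 * q ^+ n.+1).
    by field; rewrite gt_eqF.
  by rewrite ler_pM.
have -> : operator_constant / L ^+ 2 * (s * q) ^+ n.+1 =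
    (B / L ^+ 2 * s ^+ n.+1) * (B ^+ 3 * q ^+ n.+1) +
    (B * s ^+ n.+1) * (B ^+ 3 / L ^+ 2 * q ^+ n.+1 + B ^+ 3 / L ^+ 2 * q ^+ n.+1).
  by rewrite exprMn /operator_constant; ring.
apply: lerD; first by rewrite normrM ler_pM.
rewrite (Laplacian_sep (@is_derive_jets L) (@continuous_jets L)).
by rewrite normrM ler_pM// (le_trans (ler_normD _ _))// lerD.
Qed.

End scaled_cutoff.

(** * Product measure on space-time and Fubini *)

Section spacetime.
Variable R : realType.

(* A named copy of [lebesgue3], to carry the sigma-finite structure that
   inference does not find on a product of measures. *)
Definition space_measure : set (mspace3 R) -> \bar R := lebesgue3 R.

HB.instance Definition _ := Measure.on space_measure.

Lemma space_measureX (A B C : set (measurableTypeR R)) :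
  measurable A -> measurable B -> measurable C ->
  space_measure ((A `*` B) `*` C) =
  (@lebesgue_measure R A * @lebesgue_measure R B * @lebesgue_measure R C)%E.
Proof.
move=> mA mB mC; rewrite /space_measure product_measure1E//; last exact: measurableX.
by congr (_ * _)%E; exact: product_measure1E.
Qed.

Lemma lebesgue_measure_segment (r s : R) : r <= s ->
  @lebesgue_measure R `[r, s] = (s - r)%:E.
Proof.
move=> rs; rewrite lebesgue_measure_itv/= lte_fin lt_neqAle rs andbT.
by case: eqVneq => [->|_] //=; rewrite subrr.
Qed.

Lemma sigma_finite_space_measure : sigma_finite setT space_measure.
Proof.
pose I (n : nat) : set R := `[- n%:R, n%:R]%classic.
exists (fun n => (I n `*` I n) `*` I n).
  apply/esym; rewrite -subTset => -[[x y] z] _.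
  have [n hn] : exists n : nat, `|x| + `|y| + `|z| <= n%:R.
    have h0 : 0 <= `|x| + `|y| + `|z| by rewrite !addr_ge0.
    by exists (Num.truncn (`|x| + `|y| + `|z|)).+1; rewrite ltW// truncnS_gt.
  exists n => //; rewrite /I; split; [split|]; rewrite /= in_itv/= -ler_norml;
    apply: le_trans hn.
  - by rewrite -addrA lerDl addr_ge0.
  - by rewrite addrAC lerDr addr_ge0.
  - by rewrite lerDr addr_ge0.
move=> n; have mI : measurable (I n : set (measurableTypeR R)) by exact: measurable_itv.
split; first by do 2?apply: measurableX.
rewrite space_measureX// lebesgue_measure_segment; last by rewrite ge0_cp.
by rewrite -!EFinM ltry.
Qed.

HB.instance Definition _ := Measure_isSigmaFinite.Build _ _ _ space_measure
  sigma_finite_space_measure.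

Definition spacetime_measure : set (mspacetime R) -> \bar R :=
  (@lebesgue_measure R \x space_measure)%E.

HB.instance Definition _ := Measure.on spacetime_measure.

Local Notation D := (open_time_dom (+oo%E : \bar R)).

Lemma open_time_domE : D = `]0, +oo[%classic :> set R.
Proof.
apply/seteqP; split => t /=; rewrite in_itv/= andbT; first by case.
by move=> t0; split => //; exact: ltry.
Qed.

Lemma measurable_open_time_dom : measurable (D : set (measurableTypeR R)).
Proof. by rewrite open_time_domE; exact: measurable_itv. Qed.

(** Turns the iterated integrals of the weak identity into integrals for one measure, where they can
    be added and compared pointwise. *)
Lemma spacetime_integralE (G : (mspacetime R) -> R) :
  spacetime_measure.-integrable setT (EFin \o G) ->
  (forall t x, ~ D t -> G (t, x) = 0) ->
  (\int[@lebesgue_measure R]_(t in D) \int[lebesgue3 R]_x (G (t, x))%:E =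
   \int[spacetime_measure]_z (G z)%:E)%E.
Proof.
move=> iG G0; rewrite -(integral12_prod_meas1 iG) integral_mkcond.
apply: eq_integral => t _; rewrite patchE; case: ifPn => // /negP; rewrite inE => nDt.
rewrite /fubini_F integral0_eq// => x _ /=.
by rewrite G0.
Qed.

(** * The three terms in u of the weak identity *)

Section weak_terms.
Variables (p : R) (u : (mspacetime R) -> R) (J : set R) (K : set (space3 R)).
Hypothesis p1 : 1 < p.
Hypothesis Lu : Lp_loc_time_space +oo%E p u.
Hypotheses (cJ : compact J) (JD : J `<=` D) (cK : compact K).
Hypothesis mK : measurable (K : set (mspace3 R)).

(** Measurability of [u] is assumed for positive times only; its extension by 0 is measurable
    everywhere. *)
Let U : (mspacetime R) -> R := u \_ (D `*` setT).
Let JK : set (mspacetime R) := J `*` K.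

Let mJ : measurable (J : set (measurableTypeR R)).
Proof. exact: compact_measurable. Qed.

Let mJK : measurable JK.
Proof. exact: measurableX. Qed.

Let mU : measurable_fun setT U.
Proof.
have mDT : measurable (D `*` setT : set (mspacetime R)).
  exact: (measurableX measurable_open_time_dom measurableT).
by have [mu _] := Lu; exact: (measurable_restrictT u mDT).1 mu.
Qed.

Let UE z : JK z -> U z = u z.
Proof. by case: z => t x [/= Jt _]; rewrite /U patchE mem_set//; split => //; exact: JD. Qed.

Let mUp : measurable_fun setT (fun z => `|U z| `^ p).
Proof.
apply: (measurableT_comp (measurable_powR p)).
exact: measurableT_comp.
Qed.

Let H z := `|U z| `^ p * \1_JK z.

Let mH : measurable_fun setT H.
Proof. by apply: measurable_funM => //; exact: measurable_indic. Qed.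

(** Local integrability is given through iterated integrals; Tonelli converts it to the product
    measure. *)
Let iH : spacetime_measure.-integrable setT (EFin \o H).
Proof.
apply/integrable12ltyP; first exact/measurable_EFinP.
have [_ /(_ J K JD cJ cK)] := Lu.
apply: le_lt_trans; rewrite [leRHS]integral_mkcond.
rewrite le_eqVlt; apply/orP; left; apply/eqP.
have H1 t x : J t -> K x -> H (t, x) = `|u (t, x)| `^ p.
  by move=> Jt Kx; rewrite /H UE// indicE mem_set// mulr1.
have H0 t x : ~ (J t /\ K x) -> H (t, x) = 0.
  by move=> nJK; rewrite /H indicE memNset ?mulr0.
apply: eq_integral => t _; rewrite patchE; case: ifPn => [|/negP]; rewrite inE => Jt.
  rewrite [in RHS]integral_mkcond; apply: eq_integral => x _; rewrite patchE /=.
  case: ifPn => [|/negP]; rewrite inE => Kx; last by rewrite H0 ?normr0// => -[].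
  by rewrite H1// ger0_norm// powR_ge0.
by rewrite integral0_eq// => x _ /=; rewrite H0 ?normr0// => -[].
Qed.

Let iJK : spacetime_measure JK \is a fin_num ->
  spacetime_measure.-integrable setT (EFin \o \1_JK).
Proof.
move=> fJK; apply/integrableP; split.
  by apply/measurable_EFinP; exact: measurable_indic.
under eq_integral do rewrite gee0_abs ?lee_fin//.
by rewrite integral_indic// setIT ltey_eq fJK.
Qed.

(* Only the values of [u] on [J `*` K] matter, where [u] is integrable because
   [|u| <= |u| ^ p + 1]. *)
Lemma weak_terms_lower_bound (psi0 psi1 psi2 : (mspacetime R) -> R) (c M V : R) :
  measurable_fun setT psi0 -> measurable_fun setT psi1 -> measurable_fun setT psi2 ->
  (forall z, `|psi0 z| <= M) -> (forall z, `|psi1 z| <= M) -> (forall z, `|psi2 z| <= M) ->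
  (forall z, ~ JK z -> [/\ psi0 z = 0, psi1 z = 0 & psi2 z = 0]) ->
  (forall z, JK z -> - c <= `|u z| `^ p * psi0 z + u z * psi1 z + u z * psi2 z) ->
  spacetime_measure JK = V%:E ->
  exists a b d : R, [/\
   \int[@lebesgue_measure R]_(t in D)
     \int[lebesgue3 R]_x (`|u (t, x)| `^ p * psi0 (t, x))%:E = a%:E,
   \int[@lebesgue_measure R]_(t in D)
     \int[lebesgue3 R]_x (u (t, x) * psi1 (t, x))%:E = b%:E,
   \int[@lebesgue_measure R]_(t in D)
     \int[lebesgue3 R]_x (u (t, x) * psi2 (t, x))%:E = d%:E &
   (- (c * V) <= a + b + d)%R]%E.
Proof.
move=> m0 m1 m2 b0 b1 b2 psi_supp lower muJK.
have M0 : 0 <= M by apply: le_trans (b0 point).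
have iJK' : spacetime_measure.-integrable setT (EFin \o \1_JK) by apply: iJK; rewrite muJK.
have iM : spacetime_measure.-integrable setT (EFin \o (fun z => M * (H z + \1_JK z))).
  have := integrableZl measurableT M (integrableD measurableT iH iJK').
  by apply: eq_integrable => // z _ /=.
have H0 z : 0 <= H z by rewrite mulr_ge0 ?powR_ge0// indicE.
have dom (g : (mspacetime R) -> R) (psi : (mspacetime R) -> R) : measurable_fun setT g ->
    measurable_fun setT psi -> (forall z, `|psi z| <= M) ->
    (forall z, ~ JK z -> psi z = 0) -> (forall z, `|g z| <= `|U z| `^ p + 1) ->
    spacetime_measure.-integrable setT (EFin \o (fun z => g z * psi z)).
  move=> mg mpsi bpsi psi0E gU.
  apply: le_integrable iM => //; first by apply/measurable_EFinP; exact: measurable_funM.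
  move=> z _ /=; rewrite lee_fin.
  have [JKz|nJKz] := pselect (JK z); last first.
    by rewrite psi0E// mulr0 normr0.
  rewrite normrM mulrC [leRHS]ger0_norm; last by rewrite mulr_ge0// addr_ge0// indicE.
  by rewrite /H indicE mem_set// mulr1 ler_pM.
have Up0 z : `| `|U z| `^ p | <= `|U z| `^ p + 1 by rewrite ger0_norm ?powR_ge0// lerDl.
have U1 z : `|U z| <= `|U z| `^ p + 1.
  have [h|h] := leP `|U z| 1.
    by apply: (le_trans h); rewrite lerDr powR_ge0.
  apply: (@le_trans _ _ (`|U z| `^ p)); last by rewrite lerDl.
  rewrite -[leLHS]powRr1//; apply: ler_powR; exact: ltW.
have i0 := dom _ _ mUp m0 b0 (fun z nz => let: And3 h _ _ := psi_supp z nz in h) Up0.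
have i1 := dom _ _ mU m1 b1 (fun z nz => let: And3 _ h _ := psi_supp z nz in h) U1.
have i2 := dom _ _ mU m2 b2 (fun z nz => let: And3 _ _ h := psi_supp z nz in h) U1.
have offD t x : ~ D t -> ~ JK (t, x) by move=> nDt [/= /JD].
have UDE t x : D t -> U (t, x) = u (t, x) by move=> Dt; rewrite /U patchE mem_set.
pose I (g psi : (mspacetime R) -> R) : R := fine (\int[spacetime_measure]_z (g z * psi z)%:E)%E.
have IE (g psi : (mspacetime R) -> R) :
    spacetime_measure.-integrable setT (EFin \o (fun z => g z * psi z)) ->
    (\int[spacetime_measure]_z (g z * psi z)%:E = (I g psi)%:E)%E.
  by move=> ig; rewrite /I fineK//; exact: (integrable_fin_num measurableT ig).
exists (I (fun z => `|U z| `^ p) psi0), (I U psi1), (I U psi2); split.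
- rewrite -(IE _ _ i0) -(spacetime_integralE i0); last first.
    by move=> t x nDt; have [-> _ _] := psi_supp _ (offD _ x nDt); rewrite mulr0.
  by apply: eq_integral => t; rewrite inE => Dt; apply: eq_integral => x _; rewrite UDE.
- rewrite -(IE _ _ i1) -(spacetime_integralE i1); last first.
    by move=> t x nDt; have [_ -> _] := psi_supp _ (offD _ x nDt); rewrite mulr0.
  by apply: eq_integral => t; rewrite inE => Dt; apply: eq_integral => x _; rewrite UDE.
- rewrite -(IE _ _ i2) -(spacetime_integralE i2); last first.
    by move=> t x nDt; have [_ _ ->] := psi_supp _ (offD _ x nDt); rewrite mulr0.
  by apply: eq_integral => t; rewrite inE => Dt; apply: eq_integral => x _; rewrite UDE.
rewrite -lee_fin !EFinD -(IE _ _ i0) -(IE _ _ i1) -(IE _ _ i2).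
rewrite -(integralD measurableT i0 i1) -(integralD measurableT (integrableD measurableT i0 i1) i2).
rewrite EFinN EFinM -muJK.
(* Writing the constant as an integral over the support reduces the claim to the pointwise bound
   [lower]. *)
have -> : (- (c%:E * spacetime_measure JK) =
    \int[spacetime_measure]_z (- c * \1_JK z)%:E)%E.
  under eq_integral do rewrite EFinM.
  by rewrite integralZl// integral_indic// setIT EFinN mulNe.
apply: le_integral => //.
- by have := integrableZl measurableT (- c) iJK'.
- by apply: integrableD => //; exact: integrableD.
move=> z _; rewrite -!EFinD lee_fin.
have [JKz|nJKz] := pselect (JK z).
  by rewrite indicE mem_set// mulr1 UE//; exact: lower.
have [-> -> ->] := psi_supp _ nJKz.
by rewrite indicE memNset// !mulr0 !addr0.
Qed.

End weak_terms.
End spacetime.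

(** * Integrals of f against the growing cutoffs *)

Section source_term.
Variables (R : realType) (n : nat).


Lemma measurable_coord i : measurable_fun setT (coord i : (mspace3 R) -> measurableTypeR R).
Proof.
rewrite /coord; case: (i == 0); last case: (i == 1).
- exact: measurableT_comp measurable_fst measurable_fst.
- exact: measurableT_comp measurable_snd measurable_fst.
- exact: measurable_snd.
Qed.

Lemma measurable_sep (G : 'I_3 -> nat -> R -> R) (a : 'I_3 -> nat) :
  (forall i j, continuous (G i j)) -> measurable_fun setT (sep G a : (mspace3 R) -> R).
Proof.
move=> cG; rewrite /sep; apply: (measurable_prod (s := index_enum _)) => i _.
apply: measurableT_comp (measurable_coord i).
exact: continuous_measurable_fun.
Qed.

Lemma measurable_cutoff (L : R) : measurable_fun setT (cutoff n L : (mspace3 R) -> R).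
Proof. by apply: measurable_sep; exact: continuous_jets. Qed.

Lemma cutoff_ge0 (L : R) x : 0 <= cutoff n L x.
Proof. by rewrite cutoffE exprn_ge0// base_cutoff_ge0. Qed.

Lemma cutoff_le1 (L : R) x : cutoff n L x <= 1.
Proof. by rewrite cutoffE exprn_ile1 ?base_cutoff_ge0 ?base_cutoff_le1. Qed.

Lemma hump_homo (s r r' : R) : 0 < r -> r <= r' -> hump 0 r s <= hump 0 r' s.
Proof.
move=> r0 rr'; have r'0 : 0 < r' by apply: lt_le_trans rr'.
rewrite /hump /pos ge_max le_max lexx /= le_max; apply/orP; right.
rewrite lerD2l lerN2 subr0 !exprMn ler_wpM2l ?sqr_ge0// !exprVn.
by rewrite lef_pV2 ?posrE ?exprn_gt0// lerXn2r// nnegrE ltW.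
Qed.

(** Monotonicity in the scale is what monotone convergence will need. *)
Lemma cutoff_homo (L L' : R) x : 0 < L -> L <= L' -> cutoff n L x <= cutoff n L' x.
Proof.
move=> L0 LL'; rewrite !cutoffE lerXn2r ?nnegrE ?base_cutoff_ge0//.
apply: ler_prod => i _; rewrite hump_ge0/=; apply: hump_homo; first exact: radius_gt0.
by rewrite /radius; case: eqP => // _; rewrite lerXn2r// nnegrE ltW// (lt_le_trans L0).
Qed.

Lemma cvg_hump (s : R) i : hump 0 (radius m.+1%:R i) s @[m --> \oo] --> (1 : R).
Proof.
have lower : 1 - s ^+ 2 * harmonic m @[m --> \oo] --> (1 : R).
  have H : 1 - s ^+ 2 * harmonic m @[m --> \oo] --> 1 - s ^+ 2 * 0.
    apply: cvgB; first exact: cvg_cst.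
    by apply: cvgM; [exact: cvg_cst|exact: cvg_harmonic].
  by rewrite mulr0 subr0 in H.
apply: (squeeze_cvgr _ lower (cvg_cst (1 : R))).
(* Both radii, [m + 1] and its cube, have a square at least [m + 1], so one harmonic lower bound
   serves every coordinate. *)
apply: nearW => m; rewrite hump_le1 andbT /hump /pos le_max; apply/orP; right.
rewrite subr0 lerD2l lerN2 exprMn ler_wpM2l ?sqr_ge0// exprVn.
have m1 : 1 <= m.+1%:R :> R by rewrite ler1n.
have m0 : 0 < m.+1%:R :> R by [].
rewrite lef_pV2 ?posrE ?exprn_gt0 ?radius_gt0//.
by rewrite /radius; case: eqP => _; rewrite -?exprM ler_eXnr.
Qed.

Lemma cvg_cutoff x : cutoff n m.+1%:R x @[m --> \oo] --> (1 : R).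
Proof.
have Hb : base_cutoff m.+1%:R x @[m --> \oo] --> (1 * (1 * 1) : R).
  rewrite /base_cutoff; under eq_fun do rewrite !big_ord_recl big_ord0 mulr1.
  apply: cvgM; first exact: cvg_hump.
  by apply: cvgM; exact: cvg_hump.
have H := cvg_comp _ _ Hb (@exprn_continuous R n.+3 _).
rewrite !mulr1 expr1n in H; under eq_fun do rewrite cutoffE; exact: H.
Qed.

Lemma compact_box (L : R) : compact (box L).
Proof. by apply: compact_setX; [apply: compact_setX|]; exact: segment_compact. Qed.

Lemma measurable_box (L : R) : measurable (box L : set (mspace3 R)).
Proof. by apply: measurableX; [apply: measurableX|]; exact: measurable_itv. Qed.

Lemma cutoff_out (L : R) x : 0 < L -> ~ box L x -> cutoff n L x = 0.
Proof.
move=> L0 nb; rewrite cutoffE; have [->|/(base_cutoff_box L0)//] := eqVneq (base_cutoff L x) 0.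
by rewrite expr0n.
Qed.

Variable f : space3 R -> R.
Hypothesis Lf : L1_loc f.

Let mf : measurable_fun setT (f : (mspace3 R) -> R).
Proof. by have [mf _] := Lf; exact: mf. Qed.

(** Allowing any [g] dominated by [f] covers [f] itself and its positive and negative parts. *)
Lemma integrable_mul_cutoff (g : space3 R -> R) (L : R) : 0 < L ->
  measurable_fun setT (g : (mspace3 R) -> R) -> (forall x, `|g x| <= `|f x|) ->
  (@space_measure R).-integrable setT (fun x => (g x * cutoff n L x)%:E).
Proof.
move=> L0 mg gf; have [_ /(_ _ (@compact_box L)) fin] := Lf.
have ibox : (@space_measure R).-integrable setT (EFin \o (f \_ (box L))).
  apply/integrableP; split.
    apply/measurable_EFinP; apply/(measurable_restrictT _ (measurable_box L)).
    exact: measurable_funTS.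
  apply: le_lt_trans fin; rewrite [leRHS]integral_mkcond.
  rewrite le_eqVlt; apply/orP; left; apply/eqP; apply: eq_integral => x _ /=.
  by rewrite !patchE; case: ifPn => //=; rewrite normr0.
apply: le_integrable ibox => //.
  by apply/measurable_EFinP; apply: measurable_funM => //; exact: measurable_cutoff.
move=> x _ /=; rewrite lee_fin patchE; case: ifPn => [_|/negP]; last first.
  by rewrite inE => /(cutoff_out L0) ->; rewrite mulr0 normr0.
rewrite normrM [`|cutoff _ _ _|]ger0_norm ?cutoff_ge0//.
by apply: le_trans (gf x); rewrite ler_piMr// cutoff_le1.
Qed.

(* If [\int f > 0] then the negative part of [f] is integrable, while monotone
   convergence applies to the positive part, whose integral may be infinite. *)
Lemma source_lower_bound : (0 < \int[lebesgue3 R]_x (f x)%:E)%E ->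
  exists2 d : R, 0 < d & \forall m \near \oo,
    (d%:E <= \int[lebesgue3 R]_x (f x * cutoff n m.+1%:R x)%:E)%E.
Proof.
move=> fpos.
pose fp x := Num.max (f x) 0; pose fm x := Num.max (- f x) 0.
have mfp : measurable_fun setT (fp : (mspace3 R) -> R).
  by apply: measurable_maxr => //; exact: measurable_cst.
have mfm : measurable_fun setT (fm : (mspace3 R) -> R).
  by apply: measurable_maxr; [exact: measurableT_comp|exact: measurable_cst].
have fp0 x : 0 <= fp x by rewrite /fp le_max lexx orbT.
have fm0 x : 0 <= fm x by rewrite /fm le_max lexx orbT.
have fpm x : f x = fp x - fm x.
  by rewrite /fp /fm; case: (leP (f x) 0) => h; case: (leP (- f x) 0) => h'; lra.
have fpf x : `|fp x| <= `|f x|.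
  by rewrite ger0_norm// /fp; case: (leP (f x) 0) => h; rewrite ?normr_ge0 ?ler_norm.
have fmf x : `|fm x| <= `|f x|.
  by rewrite ger0_norm// -normrN /fm; case: (leP (- f x) 0) => h; rewrite ?normr_ge0 ?ler_norm.
have intE : (\int[lebesgue3 R]_x (f x)%:E =
    \int[@space_measure R]_x (fp x)%:E - \int[@space_measure R]_x (fm x)%:E)%E.
  rewrite integralE; congr (_ - _)%E; apply: eq_integral => x _.
    by rewrite funeposE EFin_max.
  by rewrite funenegE EFin_max.
have Ifm0 : (0 <= \int[@space_measure R]_x (fm x)%:E)%E.
  by apply: integral_ge0 => x _; rewrite lee_fin.
(* By convention [+oo - +oo] is [-oo], so an infinite negative part contradicts [fpos] even when the
   positive part is infinite too. *)
have [a aE] : exists a : R, (\int[@space_measure R]_x (fm x)%:E = a%:E)%E.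
  move: fpos Ifm0; rewrite intE; case: (\int[@space_measure R]_x (fm x)%:E)%E => [a _ _|/= + _|//].
    by exists a.
  by rewrite addeNy.
have aS : (a%:E < \int[@space_measure R]_x (fp x)%:E)%E.
  by move: fpos; rewrite intE aE sube_gt0.
(* A real level strictly between the two integrals exists even if the upper one is [+oo]; the gap
   [b - a] becomes the uniform lower bound. *)
have [b ab bS] : exists2 b : R, a < b & (b%:E < \int[@space_measure R]_x (fp x)%:E)%E.
  move: aS; case: (\int[@space_measure R]_x (fp x)%:E)%E => [s|_|//].
    by rewrite lte_fin => as_; exists ((a + s) / 2); rewrite ?lte_fin; lra.
  by exists (a + 1); rewrite ?ltrDl// ltry.
exists (b - a); first by rewrite subr_gt0.
have cvgp : (\int[@space_measure R]_x (fp x * cutoff n m.+1%:R x)%:E)%E @[m --> \oo] -->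
    (\int[@space_measure R]_x (fp x)%:E)%E.
  have -> : (\int[@space_measure R]_x (fp x)%:E =
    \int[@space_measure R]_x (limn (fun m => (fp x * cutoff n m.+1%:R x)%:E)))%E.
    apply: eq_integral => x _; apply/esym/cvg_lim => //.
    apply: cvg_EFin; first exact: nearW.
    have H := cvgM (cvg_cst (fp x)) (cvg_cutoff x).
    by rewrite mulr1 in H; exact: H.
  apply: cvg_monotone_convergence => //.
  - move=> m; apply/measurable_EFinP; apply: measurable_funM => //; exact: measurable_cutoff.
  - by move=> m x _; rewrite lee_fin mulr_ge0// cutoff_ge0.
  - move=> x _ m m' mm'; rewrite lee_fin ler_wpM2l// cutoff_homo// ler_nat ltnS.
    exact: mm'.
have Hb : \forall m \near \oo,
    (b%:E < \int[@space_measure R]_x (fp x * cutoff n m.+1%:R x)%:E)%E.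
  exact: (cvgp _ (open_ereal_gt' bS)).
near=> m.
have bm : (b%:E < \int[@space_measure R]_x (fp x * cutoff n m.+1%:R x)%:E)%E by near: m.
have m0 : 0 < m.+1%:R :> R by [].
have -> : (\int[lebesgue3 R]_x (f x * cutoff n m.+1%:R x)%:E =
    \int[@space_measure R]_x (fp x * cutoff n m.+1%:R x)%:E -
    \int[@space_measure R]_x (fm x * cutoff n m.+1%:R x)%:E)%E.
  rewrite -integralB_EFin//; [|exact: integrable_mul_cutoff..].
  by apply: eq_integral => x _; rewrite fpm mulrBl.
rewrite EFinB; apply: leeB; first exact: ltW.
rewrite -aE; apply: ge0_le_integral => //.
- by move=> x _; rewrite lee_fin mulr_ge0// cutoff_ge0.
- by apply/measurable_EFinP; apply: measurable_funM => //; exact: measurable_cutoff.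
- exact/measurable_EFinP.
- by move=> x _; rewrite lee_fin ler_piMr// cutoff_le1.
Unshelve. all: by end_near.
Qed.

End source_term.

(** * Comparison of the source with the error at scale L, and the contradiction *)

Section nonexistence.
Variable R : realType.

Local Notation D := (open_time_dom (+oo%E : \bar R)).

Lemma powR_scale (b L q : R) : 0 <= b -> 1 <= L -> 7 / 2 <= q ->
  (b / L ^+ 2) `^ q <= b `^ q / L ^+ 7.
Proof.
move=> b0 L1 q72; have L0 : 0 < L by apply: lt_le_trans L1.
have iL0 : 0 <= L^-1 by rewrite invr_ge0 ltW.
rewrite -!exprVn powRM ?exprn_ge0// ler_wpM2l ?powR_ge0//.
have -> : L^-1 ^+ 7 = (L^-1 ^+ 2) `^ (7 / 2).
  by rewrite -!powR_mulrn// -powRrM; congr (_ `^ _); field.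
apply: ger_powR => //; rewrite exprn_gt0 ?invr_gt0//=.
by rewrite exprn_ile1// invf_le1.
Qed.

Lemma measurable_bump c r n j : measurable_fun setT (bump c r n j : R -> R).
Proof. by apply: continuous_measurable_fun; exact: continuous_bump. Qed.

Section scale.
Variables (n : nat) (L : R).
Hypothesis L1 : 1 <= L.

Let L0 : 0 < L. Proof. exact: lt_le_trans L1. Qed.

Let psi t x := time_cutoff n L t * cutoff n L x.
Let psi0 (z : (mspacetime R)) := psi z.1 z.2.
Let psi1 (z : (mspacetime R)) := dtime_cutoff n L z.1 * cutoff n L z.2.
Let psi2 (z : (mspacetime R)) := Laplacian_of (@fields R) (psi z.1) z.2.
Let JK : set (mspacetime R) := time_itv L `*` box L.

Lemma time_itv_pos : time_itv L `<=` D.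
Proof.
move=> t; rewrite /time_itv /= in_itv/= => /andP[Lt _]; split; last exact: ltry.
by rewrite (lt_le_trans _ Lt)// exprn_gt0.
Qed.

Lemma time_cutoff_out t : ~ time_itv L t -> time_cutoff n L t = 0.
Proof.
move=> nt; rewrite time_cutoffE.
have [->|/(base_time_cutoff_itv L0)//] := eqVneq (base_time_cutoff L t) 0.
by rewrite expr0n.
Qed.

Lemma time_cutoff_ge0 t : 0 <= time_cutoff n L t.
Proof. by rewrite time_cutoffE exprn_ge0// hump_ge0. Qed.

Lemma test_function_psi : test_function +oo%E psi.
Proof.
apply: (@test_function_separated _ _ (box L) _ (dtime_cutoff n L) (3 * L ^+ 2)).
- exact: compact_box.
- split; first exact: C2_cutoff.
  by move=> x phix; apply: contrapT => /(cutoff_out n L0) phi0; rewrite phi0 eqxx in phix.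
- exact: C2_norm_cutoff.
- by move=> t; exact: (is_derive_bump _ _ _ (j := 0)).
- exact: continuous_bump.
- move=> t tL; apply: time_cutoff_out; rewrite /time_itv /= in_itv/= => /andP[_].
  by rewrite leNgt tL.
Qed.

Lemma derive1_psi t x : derive1 (psi^~ x) t = psi1 (t, x).
Proof.
have dt : is_derive t 1 (time_cutoff n L) (dtime_cutoff n L t)
  by exact: (is_derive_bump _ _ _ (j := 0)).
have -> : psi^~ x = cutoff n L x \*: time_cutoff n L.
  by apply/funext => s; rewrite /psi mulrC.
have [_] := is_deriveZ (cutoff n L x) dt.
by rewrite derive1E => ->; rewrite /psi1 /= mulrC.
Qed.

Lemma measurable_psi0 : measurable_fun setT psi0.
Proof.
apply: measurable_funM.
  by apply: measurableT_comp measurable_fst; exact: measurable_bump.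
by apply: measurableT_comp measurable_snd; exact: measurable_cutoff.
Qed.

Lemma measurable_psi1 : measurable_fun setT psi1.
Proof.
apply: measurable_funM.
  by apply: measurableT_comp measurable_fst; exact: measurable_bump.
by apply: measurableT_comp measurable_snd; exact: measurable_cutoff.
Qed.

Lemma measurable_psi2 : measurable_fun setT psi2.
Proof.
rewrite /psi2 /psi; under eq_fun do
  rewrite (Laplacian_sep (@is_derive_jets R n L) (@continuous_jets R n L)).
apply: measurable_funM.
  by apply: measurableT_comp measurable_fst; exact: measurable_bump.
apply: (measurableT_comp (f := fun x : (mspace3 R) => sep (jets n L) (fun k => 2 * (k == 0%R))%N x +
  (x.1.1 * x.1.2) ^+ 2 * sep (jets n L) (fun k => 2 * (k == 2%R))%N x)); last exact: measurable_snd.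
apply: measurable_funD; first by apply: measurable_sep; exact: continuous_jets.
apply: measurable_funM; last by apply: measurable_sep; exact: continuous_jets.
apply: measurable_funX; apply: measurable_funM.
  exact: (measurable_coord 0).
exact: (measurable_coord 1).
Qed.

Let q (z : (mspacetime R)) := base_time_cutoff L z.1 * base_cutoff L z.2.

Let q01 z : 0 <= q z <= 1.
Proof.
rewrite /q mulr_ge0 ?hump_ge0 ?base_cutoff_ge0//=.
by rewrite mulr_ile1 ?hump_ge0 ?base_cutoff_ge0 ?hump_le1 ?base_cutoff_le1.
Qed.

Let psi12_bound z : `|psi1 z| + `|psi2 z| <= operator_constant R n / L ^+ 2 * q z ^+ n.+1.
Proof. exact: operator_bound. Qed.

Let psi0E z : psi0 z = q z ^+ n.+3.
Proof. by rewrite /psi0 /psi time_cutoffE cutoffE exprMn. Qed.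

Let constant_ge0 : 0 <= operator_constant R n.
Proof. by rewrite mulr_ge0// exprn_ge0// bump_constant_ge0. Qed.

(** Outside the support [q] is 0, and the bounds in powers of [q] already force the derivatives to
    vanish with it. *)
Let psi_out z : ~ JK z -> [/\ psi0 z = 0, psi1 z = 0 & psi2 z = 0].
Proof.
move=> nJK; have q0 : q z = 0.
  apply: contrapT => /eqP; rewrite mulf_eq0 negb_or => /andP[q1 q2]; apply: nJK.
  by split; [exact: base_time_cutoff_itv q1|exact: base_cutoff_box q2].
have := psi12_bound z; rewrite psi0E q0 !expr0n /= mulr0 => h.
by split => //; apply/normr0_eq0/eqP; rewrite eq_le normr_ge0 andbT;
  apply: le_trans h; rewrite ?lerDl ?lerDr.
Qed.

Let psi12_le z : `|psi1 z| + `|psi2 z| <= operator_constant R n.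
Proof.
apply: le_trans (psi12_bound z) _; have /andP[q0 q1] := q01 z.
rewrite -mulrA ler_piMr// mulr_ile1 ?invr_ge0 ?exprn_ge0 ?(ltW L0)//.
  by rewrite invf_le1 ?exprn_gt0// exprn_ege1.
by rewrite exprn_ile1.
Qed.

(** The sides are [2 L ^ 2] in time and [2 L], [2 L], [2 L ^ 3] in space. *)
Lemma spacetime_measure_JK : @spacetime_measure R JK = (16 * L ^+ 7)%:E.
Proof.
rewrite /spacetime_measure product_measure1E; last exact: measurable_box; last first.
  exact: measurable_itv.
rewrite /= space_measureX; [|exact: measurable_itv..].
have L2 : 0 < L ^+ 2 by rewrite exprn_gt0.
have L3 : 0 < L ^+ 3 by rewrite exprn_gt0.
have hL := L0.
rewrite !lebesgue_measure_segment; [|lra..].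
by rewrite -!EFinM; congr (_%:E); ring.
Qed.

(** [f] does not depend on time, so the double integral is the space integral, at least [d], times
    the integral of the time cutoff. *)
Lemma source_integral_lower (f : space3 R -> R) (d : R) : L1_loc f -> 0 < d ->
  (d%:E <= \int[lebesgue3 R]_x (f x * cutoff n L x)%:E)%E ->
  (((3 / 4) ^+ n.+3 * d * L ^+ 2)%:E <=
   \int[@lebesgue_measure R]_(t in D) \int[lebesgue3 R]_x (f x * psi t x)%:E)%E.
Proof.
move=> Lf d0 df.
have [mf _] := Lf.
have iphi : (@space_measure R).-integrable setT (fun x => (f x * cutoff n L x)%:E).
  exact: (integrable_mul_cutoff n Lf L0 mf (fun=> lexx _)).
have [i iE] : exists i : R, (\int[@space_measure R]_x (f x * cutoff n L x)%:E = i%:E)%E.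
  exists (fine (\int[@space_measure R]_x (f x * cutoff n L x)%:E)%E).
  by rewrite fineK// integrable_fin_num.
have di : d <= i by rewrite -lee_fin -iE.
have -> : (\int[@lebesgue_measure R]_(t in D) \int[lebesgue3 R]_x (f x * psi t x)%:E =
           \int[@lebesgue_measure R]_(t in D) (time_cutoff n L t * i)%:E)%E.
  apply: eq_integral => t _; rewrite EFinM -iE -integralZl//.
  by apply: eq_integral => x _; rewrite -EFinM /psi mulrCA.
(* The middle half of the time interval has length [L ^ 2], and on it the base time cutoff is at
   least [1 - (1 / 2) ^ 2 = 3 / 4]. *)
pose J' : set R := `[3 / 2 * L ^+ 2, 5 / 2 * L ^+ 2]%classic.
have LL : 0 < L ^+ 2 by rewrite exprn_gt0.
have mJ' : measurable (J' : set (measurableTypeR R)) by exact: measurable_itv.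
have mT : measurable_fun setT (fun t : measurableTypeR R => (time_cutoff n L t * i)%:E).
  apply/measurable_EFinP; apply: measurable_funM; last exact: measurable_cst.
  exact: measurable_bump.
have T0 t : 0 <= time_cutoff n L t * i.
  by rewrite mulr_ge0 ?time_cutoff_ge0// (le_trans (ltW d0)).
apply: (@le_trans _ _ (\int[@lebesgue_measure R]_(t in J') (time_cutoff n L t * i)%:E)%E); last first.
  apply: ge0_subset_integral => //.
  - exact: measurable_open_time_dom.
  - exact: measurable_funTS.
  - by move=> t _; rewrite lee_fin.
  - move=> t; rewrite /J' /= in_itv/= => /andP[h _]; split; last exact: ltry.
    by apply: lt_le_trans h; rewrite mulr_gt0.
have -> : (((3 / 4) ^+ n.+3 * d * L ^+ 2)%:E =
    \int[@lebesgue_measure R]_(t in J') (cst ((3 / 4) ^+ n.+3 * d)%:E) t)%E.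
  rewrite integral_cst// [X in (_ * X)%E](_ : _ = (L ^+ 2)%:E) -?EFinM//.
  apply: etrans (lebesgue_measure_segment _) _; first by rewrite ler_pM2r//; lra.
  by congr (_%:E); field.
apply: ge0_le_integral => //.
- by move=> t _; rewrite lee_fin mulr_ge0 ?exprn_ge0// ltW.
- exact: measurable_funTS.
move=> t; rewrite /J' /= in_itv/= => /andP[t1 t2]; rewrite lee_fin.
apply: ler_pM; [by rewrite exprn_ge0|exact: ltW| |exact: di].
rewrite time_cutoffE lerXn2r ?nnegrE ?hump_ge0//.
rewrite /base_time_cutoff /hump /pos le_max; apply/orP; right.
have h1 : (t - 2 * L ^+ 2) / L ^+ 2 <= 1 / 2 by rewrite ler_pdivrMr//; lra.
have h2 : - (1 / 2) <= (t - 2 * L ^+ 2) / L ^+ 2 by rewrite ler_pdivlMr//; lra.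
set y := (t - _) / _ in h1 h2 *; nra.
Qed.

(** The source integral is minus the sum of the terms in [u], and that sum is at least [- A / L ^ 7]
    times the volume [16 L ^ 7]: the scale cancels on the right. *)
Lemma source_scale_bound (p : R) (f u0 : space3 R -> R) (u : R * space3 R -> R) (d : R) :
  1 < p -> p < 7 / 5 -> 2 <= n.+1%:R * (p - 1) -> L1_loc f -> 0 < d ->
  (d%:E <= \int[lebesgue3 R]_x (f x * cutoff n L x)%:E)%E ->
  global_weak_solution (@fields R) p f u0 u ->
  (3 / 4) ^+ n.+3 * d * L ^+ 2 <= 16 * operator_constant R n `^ (p / (p - 1)).
Proof.
move=> p1 p75 np Lf d0 df [Lu weak].
set A := operator_constant R n `^ _.
have p10 : 0 < p - 1 by rewrite subr_gt0.
have p'72 : 7 / 2 <= p / (p - 1) by rewrite ler_pdivlMr//; lra.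
have lower (z : (mspacetime R)) : JK z ->
    - (A / L ^+ 7) <= `|u z| `^ p * psi0 z + u z * psi1 z + u z * psi2 z.
  move=> _; have C0 : 0 <= operator_constant R n / L ^+ 2.
    by rewrite divr_ge0// exprn_ge0// ltW.
  (* Since [psi0] is exactly [q ^+ n.+3], the first term of this bound is cancelled by the nonlinear
     term, leaving only the error. *)
  have young := young_cutoff (normr_ge0 (u z)) C0 (q01 z) p1 np.
  have scale := powR_scale constant_ge0 L1 p'72.
  have h : `|u z * psi1 z + u z * psi2 z| <=
      `|u z| * (operator_constant R n / L ^+ 2 * q z ^+ n.+1).
    by rewrite -mulrDr normrM ler_wpM2l// (le_trans (ler_normD _ _)).
  move: h; rewrite ler_norml psi0E -/A => /andP[h _].
  rewrite -/A in scale; lra.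
have B0 z : `|psi0 z| <= operator_constant R n + 1.
  have /andP[q0 q1] := q01 z.
  by rewrite psi0E ger0_norm ?exprn_ge0// (le_trans (exprn_ile1 _ q0 q1))// lerDr.
have B1 z : `|psi1 z| <= operator_constant R n + 1.
  by have := psi12_le z; have := normr_ge0 (psi2 z); lra.
have B2 z : `|psi2 z| <= operator_constant R n + 1.
  by have := psi12_le z; have := normr_ge0 (psi1 z); lra.
have [a [b [c [aE bE cE abc]]]] := weak_terms_lower_bound p1 Lu
  (@segment_compact _ _ _) time_itv_pos (@compact_box _ L) (@measurable_box _ L)
  measurable_psi0 measurable_psi1 measurable_psi2 B0 B1 B2 psi_out lower spacetime_measure_JK.
have psi_ge0 t x : time_dom +oo%E t -> 0 <= psi t x.
  by move=> _; rewrite mulr_ge0 ?time_cutoff_ge0 ?cutoff_ge0.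
have := weak psi test_function_psi psi_ge0.
have -> : (\int[lebesgue3 R]_x (u0 x * psi 0%R x)%:E = 0)%E.
  apply: integral0_eq => x _; rewrite /psi time_cutoff_out ?mul0r ?mulr0//.
  rewrite /time_itv /= in_itv/= => /andP[+ _].
  by rewrite leNgt exprn_gt0.
have -> : (\int[@lebesgue_measure R]_(t in D)
    \int[lebesgue3 R]_x (u (t, x) * derive1 (psi^~ x) t)%:E = b%:E)%E.
  rewrite -bE; apply: eq_integral => t _; apply: eq_integral => x _.
  by rewrite derive1_psi.
rewrite aE cE.
have := source_integral_lower Lf d0 df.
(* The other terms being real, the value [+oo] would contradict the identity, and [-oo] the lower
   bound. *)
case: (\int[@lebesgue_measure R]_(t in D) \int[lebesgue3 R]_x (f x * psi t x)%:E)%E => [r||] //.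
rewrite lee_fin => Xr; rewrite adde0 -!EFinD => -[abrc].
have L7 : A / L ^+ 7 * (16 * L ^+ 7) = 16 * A by field; rewrite gt_eqF.
rewrite L7 in abc; lra.
Qed.

End scale.
End nonexistence.

Theorem theorem4p3 (R : realType) (p : R) (u0 f : space3 R -> R) :
  1 < p -> p < 7 / 5 ->
  L1_loc u0 -> L1_loc f ->
  (0 < \int[lebesgue3 R]_x (f x)%:E)%E ->
  ~ exists u : R * space3 R -> R, global_weak_solution (@fields R) p f u0 u.
Proof.
move=> p1 p75 _ Lf fpos [u weak].
have p10 : 0 < p - 1 by rewrite subr_gt0.
(* The power is fixed first and [d] next, so that [c] and [B] below do not depend on the scale. *)
have [n np] : exists n : nat, 2 <= n.+1%:R * (p - 1).
  exists (Num.truncn (2 / (p - 1))).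
  by rewrite -ler_pdivrMr// ltW// truncnS_gt.
have [d d0 Hd] := source_lower_bound n Lf fpos.
pose c := (3 / 4) ^+ n.+3 * d.
have c0 : 0 < c by rewrite mulr_gt0// exprn_gt0.
pose B := 16 * operator_constant R n `^ (p / (p - 1)).
have small : \forall m \near \oo, c * m.+1%:R ^+ 2 <= B.
  apply: filterS Hd => m dm.
  have m1 : 1 <= m.+1%:R :> R by rewrite ler1n.
  exact: (source_scale_bound m1 p1 p75 np Lf d0 dm weak).
have [N _ HN] := small.
(* Exceeding [B / c] with [m + 1] itself is enough, because [m + 1 >= 1] is at most its square. *)
pose m := maxn N (Num.truncn (B / c)).
have Bm : B / c < m.+1%:R.
  by apply: lt_le_trans (truncnS_gt _) _; rewrite ler_nat ltnS leq_maxr.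
have := HN m (leq_maxl _ _); rewrite /= => Hm.
have m1 : 1 <= m.+1%:R :> R by rewrite ler1n.
move: Bm; rewrite ltr_pdivrMr// => Bm; nra.
Qed.
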